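(* Let $\boldsymbol A\in\mathbb R^{m\times n}$ be a known matrix with full column rank and let $\boldsymbol D\in\mathbb R^{n\times p}$, $n\le p$, be a known matrix with full row rank. Let $s$ be a nonnegative integer with $s<p$ and suppose $\operatorname{spark}(\boldsymbol D)>2s$. Let $\boldsymbol x\in\mathcal S=\{\boldsymbol x\in\mathbb R^n:\boldsymbol x=\boldsymbol D\boldsymbol\alpha\text{ for some }\boldsymbol\alpha\in\mathbb R^p\text{ with }\|\boldsymbol\alpha\|_0\le s\}$ be an unknown deterministic parameter, to be estimated from $\boldsymbol y=\boldsymbol A\boldsymbol x+\boldsymbol w$, where $\boldsymbol w\in\mathbb R^m$ has i.i.d. Gaussian entries with mean zero and variance $\sigma^2>0$. Let $\widehat{\boldsymbol x}$ be a finite-variance estimator which is $\mathcal S$-unbiased at $\boldsymbol x$. Then its covariance at $\boldsymbol x$ satisfies $$\operatorname{Cov}(\widehat{\boldsymbol x})\succeq\sigma^2(\boldsymbol A^T\boldsymbol A)^{-1}\quad\text{when }\|\boldsymbol r(\boldsymbol x)\|_0<s,$$ $$\operatorname{Cov}(\widehat{\boldsymbol x})\succeq\sigma^2\left(\boldsymbol P\boldsymbol A^T\boldsymbol A\boldsymbol P\right)^{\dagger}\quad\text{when }\|\boldsymbol r(\boldsymbol x)\|_0=s.$$ Here $\boldsymbol r(\boldsymbol x)$ is the unique vector in $\mathbb R^p$ with $\boldsymbol x=\boldsymbol D\boldsymbol r(\boldsymbol x)$ and $\|\boldsymbol r(\boldsymbol x)\|_0\le s$, and, when $\|\boldsymbol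 r(\boldsymbol x)\|_0=s$, $\boldsymbol P=\boldsymbol D_{\boldsymbol x}(\boldsymbol D_{\boldsymbol x}^T\boldsymbol D_{\boldsymbol x})^{-1}\boldsymbol D_{\boldsymbol x}^T$, where $\boldsymbol D_{\boldsymbol x}$ is the $n\times s$ matrix consisting of the columns of $\boldsymbol D$ indexed by $\operatorname{supp}(\boldsymbol r(\boldsymbol x))$.
   Context: Notation: $\|\boldsymbol v\|_0$ is the number of nonzero entries of $\boldsymbol v$; $\operatorname{supp}(\boldsymbol v)$ is the set of indices of its nonzero entries; $\boldsymbol M^\dagger$ is the Moore--Penrose pseudoinverse of $\boldsymbol M$; $\boldsymbol M_1\succeq\boldsymbol M_2$ means $\boldsymbol M_1-\boldsymbol M_2$ is positive semidefinite. $\operatorname{spark}(\boldsymbol D)$ is the smallest integer $k$ such that there exist $k$ linearly dependent columns of $\boldsymbol D$ ($+\infty$ if there is none). The condition $\operatorname{spark}(\boldsymbol D)>2s$ guarantees that $\boldsymbol r(\boldsymbol x)$ is well defined for each $\boldsymbol x\in\mathcal S$. An estimator is a (measurable) function $\widehat{\boldsymbol x}=\widehat{\boldsymbol x}(\boldsymbol y)\in\mathbb R^n$ of the measurements. For $\boldsymbol x'\in\mathbb R^n$, let $p(\boldsymbol y;\boldsymbol x')$ be the density of $\boldsymbol y=\boldsymbol A\boldsymbol x'+\boldsymbol w$. The bias is $\boldsymbol b(\boldsymbol x')=E\{\widehat{\boldsymbol x}\}-\boldsymbol x'$, with expectation over $\boldsymbol y\sim p(\cdot;\boldsymbol x')$,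 and the bias gradient matrix at $\boldsymbol x$ is $\boldsymbol B=\partial\boldsymbol b/\partial\boldsymbol x$, the $n\times n$ matrix whose $ij$th entry is $\partial b_i/\partial x_j$ evaluated at $\boldsymbol x$. $\operatorname{Cov}(\widehat{\boldsymbol x})$ is the covariance matrix of $\widehat{\boldsymbol x}$ under $p(\cdot;\boldsymbol x)$, and finite-variance means that this covariance is finite. As a standing regularity assumption, integration with respect to $\boldsymbol y$ and differentiation with respect to the parameter can be interchanged, in particular in $E\{\widehat{\boldsymbol x}\}=\int\widehat{\boldsymbol x}(\boldsymbol y)\,p(\boldsymbol y;\boldsymbol x')\,d\boldsymbol y$. $\mathcal S$-unbiasedness: The set $\mathcal S$, a finite union of subspaces, is locally balanced: for every $\boldsymbol x\in\mathcal S$ there is a relatively open set $\mathcal C\subset\mathcal S$ containing $\boldsymbol x$ such that $\boldsymbol x+\lambda(\boldsymbol x'-\boldsymbol x)\in\mathcal C$ for all $\boldsymbol x'\in\mathcal C$ and all $|\lambda|\le1$. The feasible directions at $\boldsymbol x$ are the vectors $\boldsymbol v=\boldsymbol x'-\boldsymbol x$ with $\boldsymbol x'\in\mathcal C$, $\boldsymbol x'\ne\boldsymbol x$ (the directions along which infinitesimal movements from $\boldsymbol x$ stay in $\mathcal S$), and the feasible subspace at $\boldsymbol x$ is their linear span. The estimator $\widehat{\boldsymbol x}$ is called $\mathcal S$-unbiased at $\boldsymbol x$ if $\boldsymbol B\boldsymbol v=\boldsymbol 0$ for every feasible direction $\boldsymbol v$ at $\boldsymbol x$, equivalently for every $\boldsymbol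 v$ in the feasible subspace at $\boldsymbol x$. *)

(* Defs.v *)
From HB Require Import structures.
From mathcomp Require Import all_boot all_order all_algebra.
From mathcomp Require Import all_classical all_reals all_analysis.

Set Implicit Arguments.
Unset Strict Implicit.
Unset Printing Implicit Defensive.

Import Order.TTheory GRing.Theory Num.Theory.
Import numFieldNormedType.Exports.

Local Open Scope classical_set_scope.
Local Open Scope ring_scope.

Section linear_algebra.
Context {R : realType}.

Definition supp {p} (v : 'cV[R]_p) : {set 'I_p} := [set i | v i 0 != 0]%SET.

Definition norm0 {p} (v : 'cV[R]_p) : nat := #|supp v|.

Definition psd {n} (M : 'M[R]_n) : Prop :=
  M^T = M /\ forall v : 'cV[R]_n, 0 <= (v^T *m M *m v) 0 0.

Definition psd_ge {n} (M1 M2 : 'M[R]_n) : Prop := psd (M1 - M2).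

Definition penrose {m n} (M : 'M[R]_(m, n)) (X : 'M[R]_(n, m)) : Prop :=
  [/\ M *m X *m M = M, X *m M *m X = X,
      (M *m X)^T = M *m X & (X *m M)^T = X *m M].

(* Every real matrix has exactly one matrix satisfying the Penrose equations,
   so the default value is never used. *)
Definition pseudoinverse {m n} (M : 'M[R]_(m, n)) : 'M[R]_(n, m) :=
  xget 0 [set X | penrose M X].

(* [J] is a set of column indices, so that a repeated column counts as two
   (dependent) columns; the minimum over the empty family is +oo. *)
Definition spark {n p} (D : 'M[R]_(n, p)) : \bar R :=
  \big[Order.min/+oo%E]_(J : {set 'I_p} | ~~ free [seq col j D | j <- enum J])
    (#|J|%:R)%:E.

Definition sparse_set {n p} (D : 'M[R]_(n, p)) (s : nat) : set 'cV[R]_n :=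
  [set x | exists2 alpha : 'cV[R]_p, x = D *m alpha & (norm0 alpha <= s)%N].

(* When [2 * s < spark D] and [x] is in [sparse_set D s], exactly one vector
   has the defining property, so the default value is never used. *)
Definition sparse_rep {n p} (D : 'M[R]_(n, p)) (s : nat) (x : 'cV[R]_n) :
    'cV[R]_p :=
  xget 0 [set r | x = D *m r /\ (norm0 r <= s)%N].

Definition supp_cols {n p} (D : 'M[R]_(n, p)) (r : 'cV[R]_p) :
    'M[R]_(n, norm0 r) :=
  colsub (fun k : 'I_(norm0 r) => enum_val k : 'I_p) D.

Definition range_proj {n k} (U : 'M[R]_(n, k)) : 'M[R]_n :=
  U *m invmx (U^T *m U) *m U^T.

End linear_algebra.

Section feasible_directions.
Context {R : realType} {n : nat}.
Implicit Types (S C : set 'cV[R]_n) (x v : 'cV[R]_n).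

Definition balanced_nbhd S x C : Prop :=
  [/\ exists2 U : set 'cV[R]_n, open U & C = U `&` S,
      C x &
      forall x' (lambda : R), C x' -> `|lambda| <= 1 ->
        C (x + lambda *: (x' - x))].

(* The neighbourhood [C] is not unique, but any two choices yield the same
   directions up to a nonzero scalar factor, hence the same linear span. *)
Definition feasible_direction S x v : Prop :=
  exists C x', [/\ balanced_nbhd S x C, C x', x' != x & v = x' - x].

End feasible_directions.

(* Lebesgue measure on R^m, with R^m encoded as [m.-tuple R]: the image of the
   product of the Lebesgue measures on R and R^(m-1) under the bijection
   R * R^(m-1) -> R^m. *)
Section tuple_lebesgue.
Context {R : realType}.

Definition cons_pair m (xt : measurableTypeR R * m.-tuple R) : m.+1.-tuple R :=
  [tuple of (xt.1 : R) :: xt.2].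

Lemma measurable_cons_pair m : measurable_fun setT (@cons_pair m).
Proof.
exact: (@measurable_cons _ _ _ _ (fst : measurableTypeR R * m.-tuple R -> R)).
Qed.

Section step.
Local Open Scope ereal_scope.
Variables (m : nat) (mu : {sigma_finite_measure set (m.-tuple R) -> \bar R}).

Definition cons_measure : set (m.+1.-tuple R) -> \bar R :=
  pushforward (@lebesgue_measure R \x mu) (@cons_pair m).

Let mcons := @measurable_cons_pair m.

Let cons_measure0 : cons_measure set0 = 0.
Proof. exact: measure0. Qed.

Let cons_measure_ge0 A : 0 <= cons_measure A.
Proof. exact: measure_ge0. Qed.

Let cons_measure_sigma_additive : semi_sigma_additive cons_measure.
Proof. exact: measure_semi_sigma_additive. Qed.

HB.instance Definition _ := isMeasure.Build _ _ _ cons_measure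
  cons_measure0 cons_measure_ge0 cons_measure_sigma_additive.

Let cons_measure_sigma_finite : sigma_finite setT cons_measure.
Proof.
have /sigma_finiteP[F [TF ndF Foo]] := sigma_finiteT (@lebesgue_measure R).
have /sigma_finiteP[G [TG ndG Goo]] := sigma_finiteT mu.
pose split (t : m.+1.-tuple R) : measurableTypeR R * m.-tuple R :=
  (thead t, behead_tuple t).
have splitK (xt : measurableTypeR R * m.-tuple R) : split (cons_pair xt) = xt.
  by case: xt => a t; congr pair; exact/val_inj.
have msplit : measurable_fun setT split.
  apply/measurable_fun_pair; last exact: measurable_behead.
  exact: (@measurable_tnth _ R _ ord0).
exists (fun k => split @^-1` (F k `*` G k)).
  apply/esym/seteqP; split=> // t _ /=.
  have [k _ Fk] : (\bigcup_i F i) (split t).1 by rewrite -TF.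
  have [l _ Gl] : (\bigcup_i G i) (split t).2 by rewrite -TG.
  exists (maxn k l) => //; split.
  - by move: Fk; exact/subsetPset/ndF/leq_maxl.
  - by move: Gl; exact/subsetPset/ndG/leq_maxr.
move=> k; have [mF Fk] := Foo k; have [mG Gk] := Goo k; split.
  by rewrite -[X in measurable X]setTI; apply: msplit => //; exact: measurableX.
rewrite /cons_measure /pushforward -comp_preimage.
rewrite (_ : split \o _ = idfun); last by apply/funext => xt; exact: splitK.
by rewrite preimage_id product_measure1E// lte_mul_pinfty// ge0_fin_numE.
Qed.

HB.instance Definition _ := Measure_isSigmaFinite.Build _ _ _ cons_measure
  cons_measure_sigma_finite.

End step.

Fixpoint lebesgue_tuple (m : nat) :
    {sigma_finite_measure set (m.-tuple R) -> \bar R} :=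
  if m is m'.+1 then cons_measure (lebesgue_tuple m')
  else \d_([tuple] : 0.-tuple R).

End tuple_lebesgue.

Section gaussian_model.
Context {R : realType} {m n : nat}.

Definition observation {T : Type} (A : 'M[R]_(m, n)) (w : 'I_m -> T -> R)
    (x : 'cV[R]_n) (omega : T) : m.-tuple R :=
  [tuple (A *m x) i 0 + w i omega | i < m].

(* Some [U i] may be the whole line, so the product rule for full families
   yields the one for all subfamilies. *)
Definition iid_normal {d} {T : measurableType d} (P : probability T R)
    (sigma : R) (w : 'I_m -> {RV P >-> R}) : Prop :=
  (forall i (U : set R), measurable U ->
     distribution P (w i) U = normal_prob 0 sigma U) /\
  (forall U : 'I_m -> set R, (forall i, measurable (U i)) ->
     P (\bigcap_i (w i @^-1` U i)) = (\prod_i P (w i @^-1` U i))%E).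

(* [normal_pdf mu sigma] takes the standard deviation [sigma], and likewise for
   [normal_prob]. This is the density of [observation A w x] with respect to
   [lebesgue_tuple m] when [w] is i.i.d. normal. *)
Definition density (A : 'M[R]_(m, n)) (sigma : R) (y : m.-tuple R)
    (x : 'cV[R]_n) : R :=
  \prod_(i < m) normal_pdf ((A *m x) i 0) sigma (tnth y i).

Definition partial (j : 'I_n) (f : 'cV[R]_n -> R) (x : 'cV[R]_n) : R :=
  'D_(delta_mx j 0) f x.

(* Differentiation under the integral sign at the point [x], including the
   existence of the partial derivatives of the integral. *)
Definition interchangeable (f : m.-tuple R -> 'cV[R]_n -> R) (x : 'cV[R]_n) :
    Prop :=
  forall j : 'I_n,
    derivable (fun x' => \int[lebesgue_tuple m]_y f y x') x (delta_mx j 0) /\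
    partial j (fun x' => \int[lebesgue_tuple m]_y f y x') x =
      \int[lebesgue_tuple m]_y partial j (f y) x.

End gaussian_model.

Arguments iid_normal {R m d T} P sigma w.

Section estimators.
Context {R : realType} {m n : nat} {d : measure_display}
  {T : measurableType d} (P : probability T R).
Variables (A : 'M[R]_(m, n)) (w : 'I_m -> T -> R).
Variable xhat : m.-tuple R -> 'cV[R]_n.

Definition estimate (x : 'cV[R]_n) (i : 'I_n) (omega : T) : R :=
  xhat (observation A w x omega) i 0.

Definition cov_finite (x : 'cV[R]_n) : Prop :=
  forall i j, covariance P (estimate x i) (estimate x j) \is a fin_num.

Definition cov_mx (x : 'cV[R]_n) : 'M[R]_n :=
  \matrix_(i, j) fine (covariance P (estimate x i) (estimate x j)).

Definition bias (x : 'cV[R]_n) : 'cV[R]_n :=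
  \col_i (fine 'E_P[estimate x i] - x i 0).

Definition bias_gradient (x : 'cV[R]_n) : 'M[R]_n :=
  \matrix_(i, j) partial j (fun x' => bias x' i 0) x.

Definition unbiased_on (S : set 'cV[R]_n) (x : 'cV[R]_n) : Prop :=
  forall v, feasible_direction S x v -> bias_gradient x *m v = 0.

End estimators.

(* Main.v *)
Require Import Defs.
From HB Require Import structures.
From mathcomp Require Import all_boot all_order all_algebra.
From mathcomp Require Import all_classical all_reals all_analysis.
From mathcomp Require Import measurable_realfun ring lra.
Import Order.TTheory GRing.Theory Num.Theory.
Import numFieldNormedType.Exports.
Local Open Scope classical_set_scope.
Local Open Scope ring_scope.
Set Implicit Arguments.
Unset Strict Implicit.
Unset Printing Implicit Defensive.

(** Fix the parameter [x], put [Z u] for the derivative at [x] of the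
    log-likelihood in the direction [u], and let
    [q u = |A u|^2 / sigma^2].  The Cramer-Rao argument shows, for every [v] and
    every [u] with [B u = 0], where [B] is the bias gradient, that
      [2 v^T u - q u <= v^T Cov v]                                 (1)
    ([cramer_rao_quadratic]).  Indeed, differentiating the mean of the estimator
    under the integral sign gives [E[(xhat_i - E xhat_i) Z u] = u_i + (B u)_i],
    and (1) is the nonnegativity of the second moment of
    [\sum_i v_i (xhat_i - E xhat_i) - Z u], since [E[(Z u)^2] <= q u].

    The moments of [Z u] are not computed from those of the noise.  Moving the
    parameter along [u] multiplies the Gaussian density by
    [exp (h Z u - h^2 q u / 2)] ([density_line]), and a density has total mass 1,
    so [E[exp (t Z u)] = exp (t^2 q u / 2)] for all [t].  Any random variable
    whose exponential moments have this upper bound is square integrable, with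
    mean zero and second moment at most [q u] ([subgaussian_mean],
    [subgaussian_variance]).  All this rests on [integral_observation]: the law
    of the observation has density [density A sigma _ x] with respect to
    [lebesgue_tuple m], which is checked on boxes.

    If [B U = 0] for a matrix [U] of full column rank, then (1) holds with
    [u = U c] for every [c], and the choice of [c] that maximizes the left-hand
    side turns (1) into
      [Cov >= sigma^2 U (U^T A^T A U)^-1 U^T]
    ([psd_ge_of_quadratic]).

    It remains to see where [B] vanishes.  Close to [x], the union of subspaces
    [sparse_set D s] consists of those subspaces that contain [x]; hence a small
    ball around [x] cuts out a balanced neighbourhood, and each column [j] of [D]
    such that the support of [r] together with [j] has at most [s] elements is a
    feasible direction up to a scalar ([feasible_column]).  If [r] has fewer than
    [s] nonzero entries, this covers all columns of [D], which has full row rank,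
    so [B = 0] and [U = 1] gives the first bound.  If [r] has exactly [s] of them,
    this covers the columns of [supp_cols D r], which are independent because the
    spark exceeds [2 s]; with [U = supp_cols D r] the matrix
    [U (U^T A^T A U)^-1 U^T] is the pseudoinverse in the second bound
    ([pseudoinverse_compression]). *)

(** * Measures with a density *)

Section measure_with_density.
Local Open Scope ereal_scope.
Context d (T : measurableType d) (R : realType).
Variables (mu : {measure set T -> \bar R}) (g : T -> R).

(** The measure with density [g] with respect to [mu].  The proofs are arguments
    so that they are available to the measure structure declared below. *)
Definition density_measure of measurable_fun setT g & (forall t, (0 <= g t)%R) :
  set T -> \bar R := fun A => \int[mu]_(t in A) (g t)%:E.

Hypotheses (mg : measurable_fun setT g) (g0 : forall t, (0 <= g t)%R).

Let nu := density_measure mg g0.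

Let nu0 : nu set0 = 0. Proof. exact: integral_set0. Qed.

Let nu_ge0 A : 0 <= nu A.
Proof. by apply: integral_ge0 => t _; rewrite lee_fin. Qed.

Let nu_sigma_additive : semi_sigma_additive nu.
Proof.
apply: semi_sigma_additive_nng_induced; last by move=> t; rewrite lee_fin.
exact/measurable_EFinP.
Qed.

HB.instance Definition _ := isMeasure.Build _ _ _ (density_measure mg g0)
  nu0 nu_ge0 nu_sigma_additive.

Import HBNNSimple.

Lemma ge0_integral_density_measure (f : T -> \bar R) :
  measurable_fun setT f -> (forall t, 0 <= f t) ->
  \int[density_measure mg g0]_t f t = \int[mu]_t (f t * (g t)%:E).
Proof.
move=> mf f0.
have mE : measurable_fun setT (EFin \o g) by exact/measurable_EFinP.
have gE0 t : 0 <= (g t)%:E by rewrite lee_fin.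
pose h := nnsfun_approx measurableT mf.
have hf t : (EFin \o h n) t @[n --> \oo] --> f t.
  exact: cvg_nnsfun_approx.
transitivity (limn (fun n => \int[density_measure mg g0]_t (h n t)%:E)).
  rewrite -monotone_convergence//.
  - by apply: eq_integral => t _; apply/esym/cvg_lim => //; exact: hf.
  - by move=> n; apply/measurable_EFinP.
  - by move=> n t _; rewrite lee_fin.
  - by move=> t _ a b ab; rewrite lee_fin; exact/lefP/nd_nnsfun_approx.
transitivity (limn (fun n => \int[mu]_t ((h n t)%:E * (g t)%:E))); last first.
  rewrite -monotone_convergence//.
  - apply: eq_integral => t _; apply/cvg_lim => //.
    by apply: cvgeZr => //; exact: hf.
  - by move=> n; apply: emeasurable_funM => //; exact/measurable_EFinP.
  - by move=> n t _; rewrite mule_ge0 ?lee_fin.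
  - move=> t _ a b ab; rewrite lee_wpmul2r ?lee_fin//.
    exact/lefP/nd_nnsfun_approx.
congr (limn _); apply/funext => n.
(* Both sides are linear in the simple function [h n]: decompose it into
   indicators. *)
have m1 r : measurable_fun setT (fun t => (r * \1_(h n @^-1` [set r]) t)%:E).
  by apply/measurable_EFinP; exact: measurable_funM.
transitivity (\int[density_measure mg g0]_t
   (\sum_(r \in range (h n)) (r * \1_(h n @^-1` [set r]) t)%:E)).
  by apply: eq_integral => t _; rewrite fimfunE -fsumEFin.
rewrite ge0_integral_fsum//; last by move=> r t _; exact: nnfun_muleindic_ge0.
transitivity (\int[mu]_t (\sum_(r \in range (h n))
    ((r * \1_(h n @^-1` [set r]) t)%:E * (g t)%:E))); last first.
  apply: eq_integral => t _.
  rewrite -ge0_mule_fsuml => [|r]; last exact: nnfun_muleindic_ge0.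
  by rewrite fsumEFin// -(fimfunE _ t).
rewrite ge0_integral_fsum//; last 2 first.
  - by move=> r; apply: emeasurable_funM.
  - by move=> r t _; rewrite mule_ge0//; exact: nnfun_muleindic_ge0.
apply: eq_fsbigr => r /set_mem[t0 _ <-].
have r0 : (0 <= h n t0)%R by [].
under eq_integral do rewrite EFinM.
rewrite ge0_integralZl//; last exact/measurable_EFinP.
under [RHS]eq_integral do rewrite EFinM -muleA.
rewrite [RHS]ge0_integralZl//; first last.
  by move=> t _; rewrite mule_ge0 ?lee_fin.
  by apply: emeasurable_funM => //; exact/measurable_EFinP.
congr (_ * _); rewrite integral_indic// setIT /= /density_measure.
rewrite integral_mkcond; apply: eq_integral => t _.
rewrite patchE indicE; case: ifPn; rewrite ?mul1e ?mul0e//.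
Qed.

End measure_with_density.

(** * Lebesgue measure on R^m *)

Section lebesgue_tuple_product.
Context (R : realType).

Lemma measurable_prod_tnth m (f : 'I_m -> R -> R) :
  (forall i, measurable_fun setT (f i)) ->
  measurable_fun [set: m.-tuple R] (fun y => \prod_(i < m) f i (tnth y i)).
Proof.
move=> mf; apply: measurable_prod => i _.
apply: measurableT_comp; first exact: mf.
exact: measurable_tnth.
Qed.

Local Open Scope ereal_scope.

(** Fubini for functions with separated variables. *)
Lemma integral_lebesgue_tuple_prod m (f : 'I_m -> R -> R) :
  (forall i, measurable_fun setT (f i)) -> (forall i t, (0 <= f i t)%R) ->
  \int[@lebesgue_tuple R m]_y (\prod_(i < m) f i (tnth y i))%:E =
  \prod_(i < m) \int[lebesgue_measure]_t (f i t)%:E.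
Proof.
elim: m f => [|m IHm] f mf f0.
  rewrite big_ord0 integral_dirac//=; last first.
    by apply/measurable_EFinP; exact: measurable_prod_tnth.
  by rewrite diracT mul1e big_ord0.
rewrite (@eq_measure_integral _ _ _ _
  (pushforward (@lebesgue_measure R \x lebesgue_tuple m) (@cons_pair R m))); last by [].
  exact: measurable_cons_pair.
move=> mcons; rewrite ge0_integral_pushforward//=; first last.
- by move=> y _; rewrite lee_fin prodr_ge0.
- by apply/measurable_EFinP; exact: measurable_prod_tnth.
rewrite preimage_setT.
under eq_integral do rewrite /comp.
set F := (X in integral _ _ X).
have -> : F = fun z => (f ord0 z.1)%:E *
    (\prod_(i < m) f (lift ord0 i) (tnth z.2 i))%:E.
  apply/funext => z; rewrite /F /= big_ord_recl EFinM.
  by congr (_ * _%:E); apply: eq_bigr => i _; rewrite tnthS.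
have mtail := measurable_prod_tnth (fun i => mf (lift ord0 i)).
rewrite fubini_tonelli1; first last.
- by move=> z; rewrite mule_ge0 ?lee_fin ?prodr_ge0.
- apply: emeasurable_funM; apply/measurable_EFinP.
    exact: (measurableT_comp (mf ord0)).
  exact: (measurableT_comp mtail).
rewrite /fubini_F big_ord_recl /=.
under eq_integral.
  move=> t _; rewrite ge0_integralZl//; first last.
  - by rewrite lee_fin.
  - by move=> y _; rewrite lee_fin prodr_ge0.
  - exact/measurable_EFinP.
  rewrite (IHm (fun i => f (lift ord0 i)))//; over.
rewrite ge0_integralZr//.
- by apply/measurable_EFinP; exact: mf.
- by move=> t _; rewrite lee_fin.
- by rewrite prode_ge0// => i _; apply: integral_ge0 => t _; rewrite lee_fin.
Qed.

End lebesgue_tuple_product.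

(** * Law of the Gaussian observation *)

Section gaussian_observation.
Context (R : realType).

Let shiftR (c : R) : measurableTypeR R -> measurableTypeR R := fun t => c + t.

Let measurable_shiftR c : measurable_fun setT (shiftR c).
Proof. exact: measurable_funD. Qed.

Lemma lebesgue_measure_shift (c : R) (U : set (measurableTypeR R)) :
  measurable U ->
  pushforward (@lebesgue_measure R) (shiftR c) U = lebesgue_measure U.
Proof.
pose X : {mfun measurableTypeR R >-> measurableTypeR R} :=
  HB.pack (shiftR c) (isMeasurableFun.Build _ _ _ _ _ (measurable_shiftR c)).
move=> mU; apply/esym.
(* Lebesgue measure is determined by its values on half-open intervals. *)
apply: (@lebesgue_measure_unique R (pushforward lebesgue_measure X)) => //.
move=> _ [[a b]] _ <-.
rewrite /= /pushforward.
rewrite (_ : shiftR c @^-1` `]a, b] = `]a - c, b - c]%classic); last first.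
  by apply/seteqP; split=> t /=; rewrite !in_itv/= ltrBlDl lerBrDl.
rewrite !lebesgue_measure_itv/= !lte_fin ltrD2r; case: ifPn => // _.
by rewrite -!EFinB; congr EFin; ring.
Qed.

Lemma normal_prob_shift (c sigma : R) (U : set R) :
  sigma != 0 -> measurable U ->
  normal_prob 0 sigma [set t | U (c + t)] = normal_prob c sigma U.
Proof.
move=> s0 mU; rewrite /normal_prob.
rewrite [RHS](@eq_measure_integral _ _ _ _
  (pushforward (@lebesgue_measure R) (shiftR c))); last first.
  by move=> V mV _; rewrite /= lebesgue_measure_shift.
rewrite ge0_integral_pushforward//; first last.
- by move=> t _; rewrite lee_fin normal_pdf_ge0.
- apply/measurable_EFinP; apply: measurable_funTS.
  exact: measurable_normal_pdf.
apply: eq_integral => t _ /=; congr EFin.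
by rewrite !normal_pdfE// (normal_fun_center c) /= addrAC subrr add0r.
Qed.

End gaussian_observation.

(** The box of R^m with sides [U i]. *)
Definition tuple_box (R : realType) m (U : 'I_m -> set R) : set (m.-tuple R) :=
  \bigcap_i [set y | U i (tnth y i)].

Section boxes.
Context (R : realType) (m : nat).

(** The boxes with measurable sides; they form a pi-system that generates the
    sigma-algebra of R^m. *)
Definition tuple_boxes : set (set (m.-tuple R)) :=
  [set E | exists2 U : 'I_m -> set R,
    (forall i, measurable (U i)) & E = tuple_box U].

Lemma tuple_boxes_setI : setI_closed tuple_boxes.
Proof.
move=> _ _ [U mU ->] [V mV ->]; exists (fun i => U i `&` V i).
  by move=> i; exact: measurableI.
by rewrite /tuple_box -bigcapI; apply: eq_bigcapr.
Qed.

Lemma measurable_tuple_box (U : 'I_m -> set R) : (forall i, measurable (U i)) ->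
  measurable (tuple_box U).
Proof.
move=> mU; apply: fin_bigcap_measurable => // i _.
rewrite -[X in measurable X]setTI.
exact: (@measurable_tnth _ R m i measurableT (U i) (mU i)).
Qed.

Lemma measurable_tuple_boxes :
  (measurable : set (set (m.-tuple R))) = <<s tuple_boxes>>.
Proof.
apply/seteqP; split; last first.
  apply: smallest_sub; first exact: sigma_algebra_measurable.
  by move=> _ [U mU ->]; exact: measurable_tuple_box.
apply: smallest_sub; first exact: smallest_sigma_algebra.
move=> E; rewrite -bigcup_seq => -[i _ [V mV <-]].
apply: sub_sigma_algebra; exists (fun j => if j == i then V else setT).
  by move=> j; case: ifP.
rewrite setTI /tuple_box; apply/seteqP; split => y /=.
  by move=> Vy j _ /=; case: eqP => [->|].
by move=> /(_ i I) /=; rewrite eqxx.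
Qed.

End boxes.

Section observation_law.
Context (R : realType) (m n : nat) (A : 'M[R]_(m, n)) (sigma : R).
Context d (T : measurableType d) (P : probability T R).
Variable w : 'I_m -> {RV P >-> R}.
Hypotheses (sigma_gt0 : 0 < sigma) (wN : iid_normal P sigma w).
Implicit Types x : 'cV[R]_n.

Lemma density_ge0 y x : 0 <= density A sigma y x.
Proof. by apply: prodr_ge0 => i _; exact: normal_pdf_ge0. Qed.

Lemma measurable_density x :
  measurable_fun setT (fun y : m.-tuple R => density A sigma y x).
Proof.
apply: (measurable_prod_tnth (f := fun i => normal_pdf ((A *m x) i 0) sigma)) => i.
exact: measurable_normal_pdf.
Qed.

Lemma measurable_observation x :
  measurable_fun setT (observation A (fun i => w i : T -> R) x).
Proof.
apply/measurable_fun_tnthP => i.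
rewrite (_ : _ \o _ = fun omega => (A *m x) i 0 + w i omega); last first.
  by apply/funext => omega /=; rewrite tnth_mktuple.
exact: measurable_funD.
Qed.

(** On a box, independence factors the left-hand side, Fubini factors the
    right-hand side, and the factors agree by translation. *)
Lemma observation_box x (U : 'I_m -> set R) : (forall i, measurable (U i)) ->
  P (observation A (fun i => w i : T -> R) x @^-1` tuple_box U) =
  (\int[lebesgue_tuple m]_(y in tuple_box U) (density A sigma y x)%:E)%E.
Proof.
move=> mU; have s0 : sigma != 0 by rewrite gt_eqF.
pose c i := (A *m x) i 0.
have mc i : measurable [set t | U i (c i + t)].
  rewrite -[X in measurable X]setTI.
  by apply: (@measurable_funD _ _ _ setT (cst (c i)) id).
have -> : observation A (fun i => w i : T -> R) x @^-1` tuple_box U =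
    \bigcap_i (w i @^-1` [set t | U i (c i + t)]).
  by apply/seteqP; split=> omega /= H i _; have := H i I; rewrite /= tnth_mktuple.
case: wN => margin ->//.
transitivity (\prod_(i < m) normal_prob (c i) sigma (U i))%E.
  apply: eq_bigr => i _; rewrite -normal_prob_shift//.
  exact: margin.
rewrite [RHS]integral_mkcond.
rewrite (eq_integral (fun y : m.-tuple R =>
  (\prod_(i < m) (normal_pdf (c i) sigma (tnth y i) * \1_(U i) (tnth y i)))%:E)).
  rewrite (integral_lebesgue_tuple_prod
    (f := fun i t => normal_pdf (c i) sigma t * \1_(U i) t)).
  - apply: eq_bigr => i _; rewrite /normal_prob integral_mkcond.
    apply: eq_integral => t _; rewrite patchE indicE.
    by case: ifPn => _; rewrite ?mulr1 ?mulr0.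
  - move=> i; apply: measurable_funM; first exact: measurable_normal_pdf.
    exact: measurable_indic.
  - by move=> i t; rewrite mulr_ge0// normal_pdf_ge0.
move=> y _; rewrite patchE; case: ifPn => [/set_mem yU|/negP yU].
  congr EFin; apply: eq_bigr => i _.
  by rewrite indicE mem_set ?mulr1//; exact: (yU i).
have [i nUi] : exists i, ~ U i (tnth y i).
  apply: contrapT => /forallNP H; apply: yU; apply/mem_set => i _.
  by apply: contrapT; exact: H.
by rewrite (bigD1 i)//= indicE memNset// mulr0 mul0r.
Qed.

(** [density A sigma _ x] is the density of the observation. *)
Lemma observation_law x (E : set (m.-tuple R)) : measurable E ->
  P (observation A (fun i => w i : T -> R) x @^-1` E) =
  (\int[lebesgue_tuple m]_(y in E) (density A sigma y x)%:E)%E.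
Proof.
set obs := observation _ _ _.
have mobs : measurable_fun setT obs by exact: measurable_observation.
pose law_of : {measure set (m.-tuple R) -> \bar R} := pushforward P obs.
pose law := law_of mobs.
pose nu : {measure set (m.-tuple R) -> \bar R} :=
  density_measure (lebesgue_tuple m) (measurable_density x)
    (fun y => density_ge0 y x).
move: E; suff: forall E, measurable E -> law E = nu E by [].
apply: (measure_unique (@tuple_boxes R m) (fun=> setT)) => //.
- exact: measurable_tuple_boxes.
- exact: tuple_boxes_setI.
- move=> _; exists (fun=> setT) => //.
  by apply/seteqP; split.
- by rewrite bigcup_const.
- by move=> _ [U mU ->]; exact: observation_box.
- by move=> _; rewrite /= /pushforward preimage_setT probability_setT ltry.
Qed.

(** No integrability is assumed: the positive and negative parts are treated
    separately, so both sides agree even when the integral is infinite. *)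
Lemma integral_observation x (f : m.-tuple R -> \bar R) :
  measurable_fun setT f ->
  (\int[P]_omega f (observation A (fun i => w i : T -> R) x omega) =
   \int[lebesgue_tuple m]_y (f y * (density A sigma y x)%:E))%E.
Proof.
have ge0 (g : m.-tuple R -> \bar R) :
    measurable_fun setT g -> (forall y, 0 <= g y)%E ->
  (\int[P]_omega g (observation A (fun i => w i : T -> R) x omega) =
   \int[lebesgue_tuple m]_y (g y * (density A sigma y x)%:E))%E.
  move=> mg g0.
  rewrite -(ge0_integral_density_measure _ (measurable_density x)
    (fun y => density_ge0 y x))//.
  rewrite (@eq_measure_integral _ _ _ _ (pushforward P
     (observation A (fun i => w i : T -> R) x))).
  + exact: measurable_observation.
  + by move=> mo; rewrite ge0_integral_pushforward.
  + by move=> mo E mE _; exact/esym/observation_law.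
move=> mf; rewrite [LHS]integralE [RHS]integralE.
congr (_ - _)%E.
- transitivity (\int[P]_omega
      f^\+ (observation A (fun i => w i : T -> R) x omega))%E.
    by apply: eq_integral => omega _; rewrite !funeposE.
  rewrite (ge0 f^\+%E)//; last exact: measurable_funepos.
  by apply: eq_integral => y _; rewrite !funeposE maxe_pMl// ?mul0e// lee_fin density_ge0.
- transitivity (\int[P]_omega
      f^\- (observation A (fun i => w i : T -> R) x omega))%E.
    by apply: eq_integral => omega _; rewrite !funenegE.
  rewrite (ge0 f^\-%E)//; last exact: measurable_funeneg.
  apply: eq_integral => y _.
  by rewrite !funenegE -mulNe maxe_pMl// ?mul0e// lee_fin density_ge0.
Qed.

End observation_law.

(** * Square-integrable random variables *)

Section square_integrable.
Context d (T : measurableType d) (R : realType) (P : probability T R).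
Implicit Types f g : T -> R.

(** Measurable with an integrable square. *)
Definition square_integrable f :=
  measurable_fun setT f /\ P.-integrable setT (EFin \o (fun t => f t ^+ 2)).

Lemma square_integrable_mul f g : square_integrable f -> square_integrable g ->
  P.-integrable setT (EFin \o (fun t => f t * g t)).
Proof.
move=> [mf if2] [mg ig2].
apply: (le_integrable _ _ _ (integrableD measurableT if2 ig2)) => //.
  by apply/measurable_EFinP; exact: measurable_funM.
move=> t _ /=; rewrite lee_fin [leRHS]ger0_norm ?addr_ge0 ?sqr_ge0//.
have := sqr_ge0 (f t - g t); have := sqr_ge0 (f t + g t).
by rewrite ler_norml => ? ?; apply/andP; split; nra.
Qed.

Lemma square_integrable_cst c : square_integrable (cst c).
Proof.
split; first exact: measurable_cst.
by apply: (finite_measure_integrable_cst P (c ^+ 2) measurableT).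
Qed.

Lemma square_integrable_integrable f : square_integrable f ->
  P.-integrable setT (EFin \o f).
Proof.
move=> f2; have := square_integrable_mul f2 (square_integrable_cst 1).
by apply: eq_integrable => // t _ /=; rewrite mulr1.
Qed.

Lemma square_integrableB_cst f c : square_integrable f <->
  square_integrable (fun t => f t - c).
Proof.
have H g e : square_integrable g -> square_integrable (fun t => g t - e).
  move=> g2; split; first by apply: measurable_funB => //; case: g2.
  have := integrableD measurableT (integrableD measurableT g2.2
     (integrableZl measurableT (- e * 2) (square_integrable_integrable g2)))
     (square_integrable_cst e).2.
  apply: eq_integrable => // t _ /=; rewrite -!EFinD; congr EFin.
  by ring.
split; first exact: H.
by move=> /(H _ (- c)); congr square_integrable; apply/funext => t; ring.
Qed.

Lemma Rintegral_probability_cst c : \int[P]_t cst c t = c.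
Proof.
by rewrite Rintegral_cst// [fine _](congr1 fine (probability_setT P)) mulr1.
Qed.

Lemma Rintegral_lincomb (I : Type) (r : seq I) (c : I -> R) (F : I -> T -> R) :
  (forall i, P.-integrable setT (EFin \o F i)) ->
  P.-integrable setT (EFin \o (fun t => \sum_(i <- r) c i * F i t)) /\
  \int[P]_t (\sum_(i <- r) c i * F i t) = \sum_(i <- r) c i * \int[P]_t F i t.
Proof.
move=> iF; elim: r => [|i r [IHi IHe]].
  split.
    under eq_fun do rewrite big_nil.
    exact: (finite_measure_integrable_cst P 0 measurableT).
  by under eq_Rintegral do rewrite big_nil; rewrite Rintegral_cst// mul0r big_nil.
have ic : P.-integrable setT (EFin \o (fun t => c i * F i t)).
  by have := integrableZl measurableT (c i) (iF i); apply: eq_integrable.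
split.
  by have := integrableD measurableT ic IHi; apply: eq_integrable => // t _ /=;
    rewrite big_cons.
under eq_Rintegral do rewrite big_cons.
by rewrite RintegralD// big_cons IHe RintegralZl.
Qed.

End square_integrable.

(** * Moments of sub-Gaussian random variables *)

Section cosh_bound.
Context (R : realType).

Lemma expR_ge_deg2 (x : R) : 0 <= x -> 1 + x + x ^+ 2 / 2 <= expR x.
Proof.
move=> x0; rewrite /expR.
have <- : \sum_(0 <= i < 3) exp_coeff x i = 1 + x + x ^+ 2 / 2.
  rewrite !big_nat_recr//= big_geq// /exp_coeff /= add0r.
  by rewrite expr0 expr1 !divr1.
apply: limr_ge; first exact: is_cvg_series_exp_coeff.
exists 3%N => // k /= k3; rewrite /series /=.
rewrite [leRHS](@big_cat_nat _ _ _ 3)//= lerDl.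
by apply: sumr_ge0 => i _; rewrite /exp_coeff /= divr_ge0// exprn_ge0.
Qed.

Lemma sinh_ge (x : R) : 0 <= x -> x *+ 2 <= expR x - expR (- x).
Proof.
move=> x0; have := expR_ge_deg2 x0; rewrite expRN.
have : 0 < expR x by exact: expR_gt0.
move: (expR x) => e e0 he.
rewrite -(ler_pM2r e0) mulrBl mulVf ?gt_eqF//.
have : 0 <= (e - (1 + x + x ^+ 2 / 2)) * (e + (1 + x + x ^+ 2 / 2) - x *+ 2).
  apply: mulr_ge0; first by rewrite subr_ge0.
  nra.
have : 0 <= x ^+ 4 by rewrite exprn_ge0.
nra.
Qed.

(** With [y = x / 2], the difference of the two sides is
    [(expR y - expR (- y))^2 - (2 y)^2], so the bound on sinh applies. *)
Lemma cosh_ge (x : R) : x ^+ 2 + 2 <= expR x + expR (- x).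
Proof.
wlog x0 : x / 0 <= x => [H|].
  have [/H//|/ltW] := leP 0 x.
  by rewrite -oppr_ge0 => /H; rewrite sqrrN opprK [in leRHS]addrC.
have h0 : 0 <= x / 2 by rewrite divr_ge0.
rewrite [x]splitr; move: (x / 2) h0 => y y0.
have := sinh_ge y0; rewrite opprD !expRD expRN => hy.
have : 0 < expR y by exact: expR_gt0.
move: (expR y) hy => e hy e0.
have ee : e * e^-1 = 1 by rewrite mulfV// gt_eqF.
have : 0 <= (e - e^-1 - y *+ 2) * (e - e^-1 + y *+ 2).
  have y2 : 0 <= y *+ 2 by rewrite mulrn_wge0.
  apply: mulr_ge0; first by rewrite subr_ge0.
  by apply: addr_ge0 => //; exact: le_trans hy.
nra.
Qed.

Lemma expR_le_inv (y : R) : y < 1 -> expR y * (1 - y) <= 1.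
Proof.
move=> y1; rewrite -[leRHS](expRxMexpNx_1 y) ler_pM2l ?expR_gt0//.
exact: expR_ge1Dx.
Qed.

End cosh_bound.

Section subgaussian.
Context d (T : measurableType d) (R : realType) (P : probability T R).
Variables (Z : T -> R) (q : R).
Hypotheses (mZ : measurable_fun setT Z) (q0 : 0 <= q).
Hypothesis mgf : forall t : R,
  (\int[P]_omega (expR (t * Z omega))%:E <= (expR (t ^+ 2 * q / 2))%:E)%E.

Let integrable_expRZ t : P.-integrable setT (EFin \o (fun o => expR (t * Z o))).
Proof.
apply/integrableP; split.
  apply/measurable_EFinP; apply: measurableT_comp => //.
  exact: measurable_funM.
under eq_integral do rewrite /= ger0_norm ?expR_ge0//.
exact: le_lt_trans (mgf t) (ltry _).
Qed.

Let Rintegral_expRZ t : \int[P]_o expR (t * Z o) <= expR (t ^+ 2 * q / 2).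
Proof.
rewrite -lee_fin /Rintegral fineK ?mgf//.
by apply: integrable_fin_num => //; exact: integrable_expRZ.
Qed.

Lemma subgaussian_square_integrable : square_integrable P Z.
Proof.
split=> //.
have := integrableD measurableT (integrable_expRZ 1) (integrable_expRZ (-1)).
apply: le_integrable => //.
  by apply/measurable_EFinP; exact: measurable_funX.
move=> o _ /=; rewrite lee_fin ger0_norm ?sqr_ge0// ger0_norm; last first.
  by rewrite addr_ge0 ?expR_ge0.
by rewrite mul1r mulN1r (le_trans _ (cosh_ge (Z o)))// lerDl.
Qed.

(** From [1 + t z <= expR (t z)], the number [t * E[Z]] is at most
    [expR (t^2 q / 2) - 1 = O(t^2)], for [t] of either sign. *)
Lemma subgaussian_mean : \int[P]_o Z o = 0.
Proof.
have iZ := square_integrable_integrable subgaussian_square_integrable.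
have H t : t ^+ 2 * q / 2 < 1 ->
    t * (\int[P]_o Z o) * (1 - t ^+ 2 * q / 2) <= t ^+ 2 * q / 2.
  move=> t1.
  have : 1 + t * (\int[P]_o Z o) <= expR (t ^+ 2 * q / 2).
    apply: le_trans (Rintegral_expRZ t).
    have i1 : P.-integrable setT (EFin \o (cst 1 : T -> R)).
      exact: (finite_measure_integrable_cst P 1 measurableT).
    have iZt : P.-integrable setT (EFin \o (fun o => t * Z o)).
      by have := integrableZl measurableT t iZ; apply: eq_integrable.
    have -> : 1 + t * (\int[P]_o Z o) = \int[P]_o (1 + t * Z o).
      rewrite (RintegralD (f1 := cst 1))// RintegralZl//.
      by rewrite Rintegral_probability_cst.
    apply: le_Rintegral => //.
    - by have := integrableD measurableT i1 iZt; apply: eq_integrable.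
    - by move=> o _; exact: expR_ge1Dx.
  have := expR_le_inv t1.
  move: (expR _) (\int[P]_o Z o) => e E.
  nra.
move: H; move: (\int[P]_o Z o) => E H.
have q1 : 0 < q + 1 by rewrite ltr_wpDl.
(* A positive step [s] so small that the error terms are below [a]. *)
have small a : 0 < a -> exists s, [/\ 0 < s, s < 1, s * q < 1 & s * q < a].
  move=> a0; pose c := (a + 1) * (q + 1).
  have c0 : 0 < c by rewrite mulr_gt0// ltr_wpDl// ltW.
  have := divfK (lt0r_neq0 c0) a; have : 0 < a / c by rewrite divr_gt0.
  rewrite /c; move: (a / _) => s s0 sE; exists s.
  have sa : 0 < s * a by rewrite mulr_gt0.
  have : 0 <= s * q by rewrite mulr_ge0// ltW.
  have : s * q * a + s * a + s * q + s = a by rewrite -[RHS]sE; ring.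
  move: (s * q) => u uE u0; have ua : 0 <= u * a by rewrite mulr_ge0// ltW.
  split=> //; nra.
have absurd s e : 0 < s -> 0 < e -> s < 1 -> s * q < 1 -> s * q < e ->
    (s ^+ 2 * q / 2 < 1 -> s * e * (1 - s ^+ 2 * q / 2) <= s ^+ 2 * q / 2) -> False.
  move=> s0 e0 s1 sq1 sqe.
  have : s ^+ 2 * q < 1 by nra.
  have : s ^+ 2 * q < s * e by rewrite -mulrA ltr_pM2l.
  have : 0 < s * e by rewrite mulr_gt0.
  move: (s * e) (s ^+ 2 * q) => u v u0 vu v1.
  have : 0 < u * (1 - v) by rewrite mulr_gt0// subr_gt0.
  move=> uv h; have v2 : v / 2 < 1 by lra.
  by have := h v2; nra.
have [E0|E0|//] := ltrgt0P E.
- have [s [s0 s1 sq1 sqa]] := small _ E0.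
  by case: (absurd s E); last exact: H.
- have [|s [s0 s1 sq1 sqa]] := small (- E); first by rewrite oppr_gt0.
  case: (absurd s (- E)) => //; first by rewrite oppr_gt0.
  by have := H (- s); rewrite sqrrN mulrN mulNr.
Qed.

(** From [cosh_ge], the number [t^2 * E[Z^2]] is at most
    [2 (expR (t^2 q / 2) - 1) = t^2 q + O(t^4)]. *)
Lemma subgaussian_variance : \int[P]_o (Z o ^+ 2) <= q.
Proof.
have [_ iZ2] := subgaussian_square_integrable.
set K := \int[P]_o _.
have H t : t ^+ 2 * q / 2 < 1 -> t ^+ 2 * K * (1 - t ^+ 2 * q / 2) <= t ^+ 2 * q.
  move=> t1.
  have : t ^+ 2 * K + 2 <= expR (t ^+ 2 * q / 2) * 2.
    have i1 : P.-integrable setT (EFin \o (cst 2 : T -> R)).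
      exact: (finite_measure_integrable_cst P 2 measurableT).
    have iZt : P.-integrable setT (EFin \o (fun o => t ^+ 2 * Z o ^+ 2)).
      by have := integrableZl measurableT (t ^+ 2) iZ2; apply: eq_integrable.
    have -> : t ^+ 2 * K + 2 = \int[P]_o (t ^+ 2 * Z o ^+ 2 + 2).
      rewrite (RintegralD (f2 := cst 2))// RintegralZl//.
      by rewrite Rintegral_probability_cst.
    apply: (@le_trans _ _ (\int[P]_o (expR (t * Z o) + expR (- t * Z o)))).
      apply: le_Rintegral => //.
      - by have := integrableD measurableT iZt i1; apply: eq_integrable.
      - have := integrableD measurableT (integrable_expRZ t) (integrable_expRZ (- t)).
        by apply: eq_integrable.
      - by move=> o _; rewrite mulNr -exprMn; exact: cosh_ge.
    rewrite RintegralD//; try exact: integrable_expRZ.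
    have := Rintegral_expRZ t; have := Rintegral_expRZ (- t).
    by rewrite sqrrN; lra.
  have := expR_le_inv t1.
  move: (expR _) => e.
  nra.
rewrite leNgt; apply/negP => qK.
(* The step [(K - q) / c] is so small that [H] contradicts [q < K]. *)
pose c := (K + 1) * (q + 1).
have K0 : 0 < K by exact: le_lt_trans qK.
have c0 : 0 < c by rewrite mulr_gt0// ltr_wpDl// ltW.
have := divfK (lt0r_neq0 c0) (K - q).
have : 0 < (K - q) / c by rewrite divr_gt0// subr_gt0.
rewrite /c; move: ((K - q) / _) => s s0 sE.
have sK : 0 < s * K by rewrite mulr_gt0.
have u0 : 0 <= s * q by rewrite mulr_ge0// ltW.
have uE : s * q * K + s * K + s * q + s = K - q by rewrite -sE; ring.
have uK : 0 <= (s * q) * K by rewrite mulr_ge0// ltW.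
have [s1 sq1 sqK] : [/\ s < 1, s * q < 1 & s * q * K < K - q].
  by move: (s * q) u0 uE uK => u u0 uE uK; split=> //; nra.
have tq : s ^+ 2 * q <= s * q by rewrite ler_wpM2r//; nra.
have tK : s ^+ 2 * q * K <= s * q * K by rewrite ler_wpM2r// ltW.
have t1 : s ^+ 2 * q / 2 < 1 by lra.
have := H s t1; rewrite -[s ^+ 2 * K * _]mulrA ler_pM2l ?exprn_gt0//.
nra.
Qed.

End subgaussian.

(** * Score and Fisher information *)

Section score.
Context (R : realType) (m n : nat) (A : 'M[R]_(m, n)) (sigma : R).
Implicit Types (x u : 'cV[R]_n) (y : m.-tuple R).

(** The derivative at [x], in the direction [u], of the logarithm of the density
    of [y]. *)
Definition score x u y : R :=
  \sum_(i < m) (A *m u) i 0 * (tnth y i - (A *m x) i 0) / sigma ^+ 2.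

(** The Fisher information quadratic form, [|A u|^2 / sigma^2]. *)
Definition information u : R := \sum_(i < m) (A *m u) i 0 ^+ 2 / sigma ^+ 2.

Lemma information_ge0 u : 0 <= information u.
Proof. by apply: sumr_ge0 => i _; rewrite divr_ge0 ?sqr_ge0. Qed.

Lemma informationE u :
  information u = (u^T *m (A^T *m A) *m u) 0 0 / sigma ^+ 2.
Proof.
rewrite /information -mulr_suml; congr (_ / _).
have -> : u^T *m (A^T *m A) *m u = (A *m u)^T *m (A *m u).
  by rewrite trmx_mul !mulmxA.
by rewrite [RHS]mxE; apply: eq_bigr => i _; rewrite [(A *m u)^T _ _]mxE expr2.
Qed.

Lemma score_sum x u y :
  score x u y = \sum_j u j 0 * score x (delta_mx j 0) y.
Proof.
rewrite /score; under [RHS]eq_bigr do rewrite mulr_sumr.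
rewrite [RHS]exchange_big /=; apply: eq_bigr => i _.
under [RHS]eq_bigr do rewrite !mulrA.
rewrite -!mulr_suml mxE; congr (_ * _ / _); apply: eq_bigr => j _.
by rewrite -colE mxE mulrC.
Qed.

Lemma measurable_score x u : measurable_fun setT (score x u).
Proof.
apply: measurable_sum => i; apply: measurable_funM => //.
apply: measurable_funM => //; apply: measurable_funB => //.
exact: measurable_tnth.
Qed.

Hypothesis sigma_neq0 : sigma != 0.

Lemma density_line x u y h : density A sigma y (x + h *: u) =
  density A sigma y x * expR (h * score x u y - h ^+ 2 * information u / 2).
Proof.
rewrite /density /score /information !mulr_sumr mulr_suml -sumrB.
rewrite expR_sum -big_split /=; apply: eq_bigr => i _.
rewrite !normal_pdfE//= -[RHS]mulrA; congr (_ * _).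
rewrite /normal_fun -expRD mulmxDr -scalemxAr !mxE.
by congr expR; field.
Qed.

Lemma partial_density x y c j :
  partial j (fun x' => c * density A sigma y x') x =
  c * score x (delta_mx j 0) y * density A sigma y x.
Proof.
set v := delta_mx j 0; pose k := c * density A sigma y x.
pose g (h : R) : R := k * expR (h * score x v y - h ^+ 2 * information v / 2).
rewrite /partial -/v.
transitivity ('D_1 g 0).
  suff E : (fun h : R => h^-1 *: (((fun x' => c * density A sigma y x') \o
        shift x) (h *: v) - c * density A sigma y x)) =
      (fun h : R => h^-1 *: ((g \o shift 0) (h *: 1) - g 0)).
    by rewrite /derive E.
  apply/funext => h; rewrite /g /= [h *: v + x]addrC density_line mulrA.
  by rewrite /GRing.scale /= mulr1 addr0 !mul0r expr0n /= !mul0r subr0 expR0 mulr1.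
pose p : {poly R} := score x v y *: 'X - (information v / 2) *: 'X^2.
have -> : g = k \*: (expR \o horner p).
  apply/funext => h; rewrite /g /= /p hornerD hornerN !hornerZ hornerX hornerXn.
  by congr (k * expR _); ring.
have dp : is_derive (0 : R) 1 (horner p) (score x v y).
  apply: is_derive_eq.
  rewrite /p derivB !derivZ derivX derivXn hornerD hornerN !hornerZ hornerMn.
  by rewrite hornerXn -polyC1 hornerC /=; ring.
have e0 : expR p.[0] = 1.
  rewrite /p hornerD hornerN !hornerZ hornerX hornerXn /= expr0n /=.
  by rewrite !mulr0 subr0 expR0.
have dg : is_derive (0 : R) 1 (k \*: (expR \o horner p))
    (k *: (expR p.[0] * score x v y)).
  by apply: is_deriveZ; exact: is_derive1_comp.
by rewrite derive_val e0 mul1r /k /GRing.scale /=; ring.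
Qed.

End score.

(** * Cramer-Rao inequality *)

Section quadratic.
Context d (T : measurableType d) (R : realType) (P : probability T R).

Lemma integral_sqr_lincombB_ge0 n (F : 'I_n -> T -> R) (G : T -> R) (c : 'I_n -> R) :
  (forall i, square_integrable P (F i)) -> square_integrable P G ->
  0 <= \sum_i c i * (\sum_j c j * \int[P]_t (F i t * F j t)) -
       (\sum_i c i * \int[P]_t (F i t * G t)) *+ 2 + \int[P]_t (G t ^+ 2).
Proof.
move=> F2 G2; pose W t := \sum_i c i * F i t.
have [iWG <-] := Rintegral_lincomb (index_enum 'I_n) c
  (fun i => square_integrable_mul (F2 i) G2).
have iFW i : P.-integrable setT (EFin \o (fun t => F i t * W t)) /\
    \int[P]_t (F i t * W t) = \sum_j c j * \int[P]_t (F i t * F j t).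
  have [iS <-] := Rintegral_lincomb (index_enum 'I_n) c
    (fun j => square_integrable_mul (F2 i) (F2 j)).
  have E t : \sum_j c j * (F i t * F j t) = F i t * W t.
    by rewrite mulr_sumr; apply: eq_bigr => j _; ring.
  split; last by apply: eq_Rintegral => t _; rewrite E.
  by move: iS; apply: eq_integrable => // t _ /=; rewrite E.
under eq_bigr do rewrite -(iFW _).2.
have [iWW <-] := Rintegral_lincomb (index_enum 'I_n) c (fun i => (iFW i).1).
have iWG2 := integrableZl measurableT (2 : R) iWG.
have iB := integrableB measurableT iWW iWG2.
rewrite -mulr_natl -RintegralZl// -RintegralB//.
rewrite -RintegralD//; last by case: G2.
apply: Rintegral_ge0 => t _.
have -> : \sum_(i < n) c i * (F i t * W t) = W t ^+ 2.
  by rewrite expr2 mulr_suml; apply: eq_bigr => i _; rewrite mulrA.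
have -> : \sum_(i < n) c i * (F i t * G t) = W t * G t.
  by rewrite mulr_suml; apply: eq_bigr => i _; rewrite mulrA.
have -> : W t ^+ 2 - 2 * (W t * G t) + G t ^+ 2 = (W t - G t) ^+ 2 by ring.
exact: sqr_ge0.
Qed.

End quadratic.

Lemma derive_coord (R : realType) n (x : 'cV[R]_n) (i j : 'I_n) :
  derivable (fun x' : 'cV[R]_n => x' i 0) x (delta_mx j 0) /\
  partial j (fun x' => x' i 0) x = (i == j)%:R.
Proof.
rewrite /partial /derive /derivable.
set q := (X in lim (X @ _)).
have qE : \forall h \near (0 : R)^', q h = (i == j)%:R.
  near=> h.
  have h0 : h != 0 by near: h; exact: nbhs_dnbhs_neq.
  by rewrite /q /= !mxE eqxx andbT addrK /GRing.scale /= mulKf.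
by split; [exact: is_cvg_near_cst qE|exact: lim_near_cst].
Unshelve. all: by end_near. Qed.

Section cramer_rao.
Context (R : realType) (m n : nat) (A : 'M[R]_(m, n)) (sigma : R).
Context d (T : measurableType d) (P : probability T R).
Variables (w : 'I_m -> {RV P >-> R}) (xhat : m.-tuple R -> 'cV[R]_n) (x : 'cV[R]_n).
Hypotheses (sigma_gt0 : 0 < sigma) (wN : iid_normal P sigma w).
Hypothesis mxhat : forall i, measurable_fun setT (fun y => xhat y i 0).

(* [X x' i] is the estimate of the [i]-th coordinate and [obs x'] the observation
   when the parameter is [x']; [Z u] is the score of the observation at [x]. *)
Let obs x' : T -> m.-tuple R := observation A (fun i => w i : T -> R) x'.
Let X x' i : T -> R := estimate A (fun i => w i : T -> R) xhat x' i.
Let Z u : T -> R := fun omega => score A sigma x u (obs x omega).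
Let mobs x' : measurable_fun setT (obs x').
Proof. exact: measurable_observation. Qed.

Let sigma_neq0 : sigma != 0. Proof. by rewrite gt_eqF. Qed.

Let integral_density x' :
  (\int[lebesgue_tuple m]_y (density A sigma y x')%:E = 1)%E.
Proof.
have := integral_observation A sigma_gt0 wN x' (@measurable_cst _ _ _ _ setT 1%E).
rewrite integral_cst// mul1e => H; apply: etrans (probability_setT P).
rewrite [RHS]H.
by apply: eq_integral => y _; rewrite mul1e.
Qed.

(* The integral of [density A sigma _ (x + t *: u)] is 1. *)
Let score_mgf u t :
  (\int[P]_omega (expR (t * Z u omega))%:E =
   (expR (t ^+ 2 * information A sigma u / 2))%:E)%E.
Proof.
set q := information A sigma u.
have mf : measurable_fun setT
    (fun y => (expR (t * score A sigma x u y))%:E : \bar R).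
  apply/measurable_EFinP; apply: measurableT_comp => //.
  by apply: measurable_funM => //; exact: measurable_score.
rewrite (integral_observation A sigma_gt0 wN x mf).
transitivity (\int[lebesgue_tuple m]_y
    ((expR (t ^+ 2 * q / 2))%:E * (density A sigma y (x + t *: u))%:E))%E.
  apply: eq_integral => y _; rewrite -!EFinM density_line// mulrCA -expRD mulrC.
  by congr (_ * expR _)%:E; rewrite -/q; ring.
rewrite ge0_integralZl ?lee_fin ?expR_ge0//.
- by rewrite integral_density mule1.
- by apply/measurable_EFinP; exact: measurable_density.
- by move=> y _; rewrite lee_fin density_ge0.
Qed.

Let mZ u : measurable_fun setT (Z u).
Proof. by apply: measurableT_comp; [exact: measurable_score|exact: mobs]. Qed.

Let Z2 u : square_integrable P (Z u).
Proof.
by apply: (subgaussian_square_integrable (mZ u)) => t; rewrite score_mgf.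
Qed.

Let Zmean u : \int[P]_o Z u o = 0.
Proof.
apply: (subgaussian_mean (mZ u) (information_ge0 A sigma u)) => t.
by rewrite score_mgf.
Qed.

Let Zvariance u : \int[P]_o (Z u o ^+ 2) <= information A sigma u.
Proof.
apply: (subgaussian_variance (mZ u) (information_ge0 A sigma u)) => t.
by rewrite score_mgf.
Qed.

Hypothesis finite_cov : cov_finite P A (fun i => w i : T -> R) xhat x.
Hypothesis interch :
  forall i, interchangeable (fun y x' => xhat y i 0 * density A sigma y x') x.

Let c i : R := fine 'E_P[X x i].

Let cE i : c i = fine (\int[P]_o (X x i o)%:E)%E.
Proof. by rewrite /c unlock. Qed.

(* A finite second moment about any constant suffices for square
   integrability. *)
Let X2 i : square_integrable P (X x i).
Proof.
apply/(square_integrableB_cst _ _ (c i)).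
have mX : measurable_fun setT (X x i).
  exact: (measurableT_comp (mxhat i) (mobs x)).
split; first exact: measurable_funB.
have := finite_cov i i; rewrite unlock /= unlock => fin.
apply/integrableP; split.
  by apply/measurable_EFinP; apply: measurable_funX; exact: measurable_funB.
under eq_integral do rewrite /= ger0_norm ?sqr_ge0//.
rewrite -ge0_fin_numE; last by apply: integral_ge0 => o _; rewrite lee_fin sqr_ge0.
by move: fin; rewrite -[fine _]cE.
Qed.

Let covE i j : cov_mx P A (fun i => w i : T -> R) xhat x i j =
  \int[P]_o ((X x i o - c i) * (X x j o - c j)).
Proof. by rewrite mxE unlock /= /c unlock. Qed.

Let meanE x' i : fine 'E_P[X x' i] =
  \int[lebesgue_tuple m]_y (xhat y i 0 * density A sigma y x').
Proof.
rewrite unlock /Rintegral; congr fine.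
have mf : measurable_fun setT (fun y => (xhat y i 0)%:E : \bar R).
  exact/measurable_EFinP.
by rewrite (integral_observation A sigma_gt0 wN x' mf).
Qed.

Let bias_gradientE i j :
  bias_gradient P A (fun i => w i : T -> R) xhat x i j =
  \int[P]_o (X x i o * Z (delta_mx j 0) o) - (i == j)%:R.
Proof.
rewrite mxE.
have [dI eI] := interch i j.
have [dc ec] := derive_coord x i j.
have -> : (fun x' => bias P A (fun i => w i : T -> R) xhat x' i 0) =
    (fun x' => \int[lebesgue_tuple m]_y (xhat y i 0 * density A sigma y x')) -
    (fun x' : 'cV[R]_n => x' i 0).
  by apply/funext => x' /=; rewrite mxE meanE.
rewrite /partial deriveB// -/(partial j _ x) -/(partial j _ x) ec eI.
congr (_ - _); rewrite /Rintegral; congr fine.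
have mf : measurable_fun setT
    (fun y => (xhat y i 0 * score A sigma x (delta_mx j 0) y)%:E : \bar R).
  by apply/measurable_EFinP; apply: measurable_funM => //; exact: measurable_score.
rewrite (integral_observation A sigma_gt0 wN x mf).
by apply: eq_integral => y _; rewrite partial_density.
Qed.

(* The covariance of the estimator and the score is [1 + B], and [B u = 0]. *)
Let covXZ i u : bias_gradient P A (fun i => w i : T -> R) xhat x *m u = 0 ->
  \int[P]_o ((X x i o - c i) * Z u o) = u i 0.
Proof.
move=> Bu.
have iXZ j := square_integrable_mul (X2 i) (Z2 (delta_mx j 0)).
have XZ : \int[P]_o (X x i o * Z u o) = u i 0.
  have [_] := Rintegral_lincomb (index_enum 'I_n) (fun j => u j 0) iXZ.
  under eq_Rintegral.
    move=> o _.
    have -> : \sum_j u j 0 * (X x i o * Z (delta_mx j 0) o) = X x i o * Z u o.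
      rewrite /Z [in RHS]score_sum mulr_sumr; apply: eq_bigr => j _.
      by ring.
    over.
  move=> ->; move/matrixP/(_ i 0): Bu; rewrite !mxE => Bu.
  rewrite -[RHS]add0r -[X in _ = X + _]Bu.
  have -> : u i 0 = \sum_j (i == j)%:R * u j 0.
    rewrite (bigD1 i)//= eqxx mul1r big1 ?addr0// => j ji.
    by rewrite eq_sym (negPf ji) mul0r.
  rewrite -big_split /=; apply: eq_bigr => j _.
  by rewrite bias_gradientE; ring.
have iXZu := square_integrable_mul (X2 i) (Z2 u).
have iZ := square_integrable_integrable (Z2 u).
have icZ : P.-integrable setT (EFin \o (fun o => c i * Z u o)).
  by have := integrableZl measurableT (c i) iZ; apply: eq_integrable.
under eq_Rintegral do rewrite mulrBl.
by rewrite RintegralB// XZ RintegralZl// Zmean mulr0 subr0.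
Qed.

(** The Cramer-Rao inequality as a quadratic inequality, in the directions [u]
    in which the bias is stationary. *)
Lemma cramer_rao_quadratic (u v : 'cV[R]_n) :
  bias_gradient P A (fun i => w i : T -> R) xhat x *m u = 0 ->
  ((v^T *m u) 0 0) *+ 2 - (u^T *m (A^T *m A) *m u) 0 0 / sigma ^+ 2 <=
  (v^T *m cov_mx P A (fun i => w i : T -> R) xhat x *m v) 0 0.
Proof.
move=> Bu; rewrite -informationE.
have X2c i := (square_integrableB_cst _ _ (c i)).1 (X2 i).
have := integral_sqr_lincombB_ge0 (fun i => v i 0) X2c (Z2 u).
have -> : (v^T *m cov_mx P A (fun i => w i : T -> R) xhat x *m v) 0 0 =
  \sum_i v i 0 * (\sum_j v j 0 * \int[P]_t ((X x i t - c i) * (X x j t - c j))).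
  rewrite -mulmxA mxE; apply: eq_bigr => i _; rewrite mxE; congr (_ * _).
  by rewrite mxE; apply: eq_bigr => j _; rewrite covE mulrC.
have -> : (v^T *m u) 0 0 = \sum_i v i 0 * \int[P]_t ((X x i t - c i) * Z u t).
  by rewrite mxE; apply: eq_bigr => i _; rewrite mxE covXZ.
have := Zvariance u; lra.
Qed.

End cramer_rao.

(** * Linear algebra *)

Section matrices.
Context (R : realType).

Lemma penrose_unique m n (M : 'M[R]_(m, n)) X Y :
  penrose M X -> penrose M Y -> X = Y.
Proof.
move=> [MX XM sMX sXM] [MY YM sMY sYM].
have eM : M *m X = M *m Y.
  by rewrite -sMX -{1}MY -[M *m Y *m M *m X]mulmxA trmx_mul sMX sMY mulmxA MX.
have eX : X *m M = Y *m M.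
  by rewrite -sXM -{1}MY -[M *m Y *m M]mulmxA mulmxA trmx_mul sXM sYM -mulmxA
    [M *m (X *m M)]mulmxA MX.
by rewrite -XM -mulmxA eM mulmxA eX YM.
Qed.

Lemma pseudoinverse_eq m n (M : 'M[R]_(m, n)) X :
  penrose M X -> pseudoinverse M = X.
Proof.
move=> MX; apply: (penrose_unique (M := M)) => //.
exact: (@xgetPex _ 0 [set X | penrose M X]) (ex_intro _ X MX).
Qed.

Lemma tr_mulmx_eq0 n (u : 'cV[R]_n) : u^T *m u = 0 -> u = 0.
Proof.
move=> /matrixP/(_ 0 0); rewrite !mxE => u0; apply/colP => i; rewrite mxE.
apply/eqP; rewrite -sqrf_eq0 expr2.
have /psumr_eq0P/(_ (i)) := u0; rewrite mxE => -> // j _.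
by rewrite mxE -expr2 sqr_ge0.
Qed.

Lemma gram_unitmx n k (U : 'M[R]_(n, k)) :
  \rank U = k -> U^T *m U \in unitmx.
Proof.
move=> rU; rewrite -row_free_unit; apply: inj_row_free => v vUU.
have fU : row_free U^T by rewrite /row_free mxrank_tr rU.
apply: (row_free_inj fU); rewrite mul0mx; apply: trmx_inj; rewrite trmx0.
apply: tr_mulmx_eq0; rewrite trmxK trmx_mul trmxK.
by rewrite -mulmxA [X in _ *m X]mulmxA mulmxA vUU mul0mx.
Qed.

Lemma gram_mul_unitmx m n k (A : 'M[R]_(m, n)) (U : 'M[R]_(n, k)) :
  \rank A = n -> \rank U = k -> U^T *m (A^T *m A) *m U \in unitmx.
Proof.
move=> rA rU.
have -> : U^T *m (A^T *m A) *m U = (A *m U)^T *m (A *m U).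
  by rewrite trmx_mul !mulmxA.
apply: gram_unitmx; rewrite -mxrank_tr trmx_mul mxrankMfree ?mxrank_tr//.
by rewrite /row_free mxrank_tr rA.
Qed.

Lemma tr_invmx_sym n (N : 'M[R]_n) : N^T = N -> (invmx N)^T = invmx N.
Proof. by move=> sN; rewrite trmx_inv sN. Qed.

(** The factor [U^T U] of the projection cancels: the right-hand side, multiplied
    on either side by the compressed Gram matrix, gives the projection. *)
Lemma pseudoinverse_compression m n k (A : 'M[R]_(m, n)) (U : 'M[R]_(n, k)) :
  U^T *m U \in unitmx -> U^T *m (A^T *m A) *m U \in unitmx ->
  pseudoinverse (range_proj U *m A^T *m A *m range_proj U) =
  U *m invmx (U^T *m (A^T *m A) *m U) *m U^T.
Proof.
set G := U^T *m U; set N := _ *m U => uG uN.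
have sG : (invmx G)^T = invmx G.
  by apply: tr_invmx_sym; rewrite /G trmx_mul trmxK.
have sN : (invmx N)^T = invmx N.
  by apply: tr_invmx_sym; rewrite /N !trmx_mul !trmxK !mulmxA.
have [Q QE] : exists Q, Q = range_proj U by exists (range_proj U).
rewrite -QE; rewrite /range_proj -/G in QE.
have sQ : Q^T = Q by rewrite QE !trmx_mul trmxK sG mulmxA.
have QU : Q *m U = U by rewrite QE -!mulmxA -/G mulVmx// mulmx1.
have QQ : Q *m Q = Q by rewrite {2}QE !mulmxA QU -QE.
set M := Q *m _ *m _ *m _; set X := _ *m U^T.
have MX : M *m X = Q.
  have -> : M *m X = Q *m A^T *m A *m (Q *m U) *m invmx N *m U^T.
    by rewrite /M /X !mulmxA.
  have -> : Q *m A^T *m A *m (Q *m U) *m invmx N *m U^T =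
      U *m invmx G *m (N *m invmx N) *m U^T.
    by rewrite QU {1}QE /N !mulmxA.
  by rewrite mulmxV// mulmx1 QE.
have sX : X^T = X by rewrite /X !trmx_mul trmxK sN mulmxA.
have sM : M^T = M by rewrite /M !trmx_mul trmxK sQ !mulmxA.
have XM : X *m M = Q by rewrite -[X]sX -[M]sM -trmx_mul MX.
apply: pseudoinverse_eq; split; rewrite ?MX ?XM ?sQ//.
- by rewrite /M !mulmxA QQ.
- by rewrite /X !mulmxA QU.
Qed.

Lemma mulmx_cols_eq0 m n k (B : 'M[R]_(m, n)) (U : 'M[R]_(n, k)) :
  (forall j, B *m col j U = 0) -> B *m U = 0.
Proof.
move=> BU; apply/matrixP => i j.
have /colP/(_ i) : col j (B *m U) = 0 by rewrite colE -mulmxA -colE.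
by rewrite mxE => ->; rewrite !mxE.
Qed.

(** The bound comes from the best choice of [c] for each [v]. *)
Lemma psd_ge_of_quadratic m n k (A : 'M[R]_(m, n)) (C : 'M[R]_n)
    (U : 'M[R]_(n, k)) (s : R) :
  s != 0 -> C^T = C -> U^T *m (A^T *m A) *m U \in unitmx ->
  (forall (v : 'cV[R]_n) (c : 'cV[R]_k),
    ((v^T *m (U *m c)) 0 0) *+ 2 -
      ((U *m c)^T *m (A^T *m A) *m (U *m c)) 0 0 / s <= (v^T *m C *m v) 0 0) ->
  psd_ge C (s *: (U *m invmx (U^T *m (A^T *m A) *m U) *m U^T)).
Proof.
set N := _ *m U => s0 sC uN H.
have sN : (invmx N)^T = invmx N.
  by apply: tr_invmx_sym; rewrite /N !trmx_mul !trmxK !mulmxA.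
split.
  by rewrite linearB linearZ /= sC !trmx_mul trmxK sN mulmxA.
move=> v; set K := U *m _ *m _.
(* The critical point in [c] of the left-hand side of [H]. *)
have := H v (s *: (invmx N *m U^T *m v)).
set a := (v^T *m K *m v) 0 0.
have -> : U *m (s *: (invmx N *m U^T *m v)) = s *: (K *m v).
  by rewrite -scalemxAr !mulmxA.
have -> : (v^T *m (s *: (K *m v))) 0 0 = s * a.
  by rewrite -scalemxAr mxE mulmxA.
have sK : K^T = K by rewrite /K !trmx_mul trmxK sN mulmxA.
have KAK : K *m (A^T *m A) *m K = K.
  rewrite {1}/K {1}/K.
  have -> : U *m invmx N *m U^T *m (A^T *m A) *m (U *m invmx N *m U^T) =
    U *m (invmx N *m N *m invmx N) *m U^T by rewrite /N !mulmxA.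
  by rewrite mulVmx// mul1mx.
have -> : ((s *: (K *m v))^T *m (A^T *m A) *m (s *: (K *m v))) 0 0 / s = s * a.
  rewrite [(s *: _)^T]linearZ /= -!scalemxAl -!scalemxAr mxE [X in s * X]mxE.
  rewrite trmx_mul sK.
  have -> : v^T *m K *m (A^T *m A) *m (K *m v) = v^T *m (K *m (A^T *m A) *m K) *m v.
    by rewrite !mulmxA.
  by rewrite KAK -/a mulrC mulrA mulVf// mul1r.
rewrite mulmxBr mulmxBl -scalemxAr -scalemxAl.
have -> (X Y : 'M[R]_1) : (X - s *: Y) 0 0 = X 0 0 - s * Y 0 0 by rewrite !mxE.
rewrite -/a; lra.
Qed.

End matrices.

(** * Feasible directions of the sparse set *)

Section sparse_geometry.
Context (R : realType) (n p s : nat) (D : 'M[R]_(n, p)).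
Implicit Types (x y : 'cV[R]_n) (I : {set 'I_p}).

(** The subspace spanned by the columns of [D] with indices in [I]. *)
Definition supported_span I : set 'cV[R]_n :=
  [set x | exists2 alpha : 'cV[R]_p, x = D *m alpha & supp alpha \subset I].

Lemma supp_comb (alpha beta : 'cV[R]_p) (a : R) I :
  supp alpha \subset I -> supp beta \subset I ->
  supp (alpha + a *: beta) \subset I.
Proof.
move=> /fintype.subsetP aI /fintype.subsetP bI.
apply/fintype.subsetP => i; rewrite inE !mxE => abi.
have [a0|/eqP a0] := eqVneq (alpha i 0) 0; last by apply: aI; rewrite inE; apply/eqP.
apply: bI; rewrite inE; apply: contra_neq abi => ->.
by rewrite a0 mulr0 addr0.
Qed.

Lemma supported_span_line I x y (a : R) :
  supported_span I x -> supported_span I y -> supported_span I (x + a *: (y - x)).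
Proof.
move=> [al -> alI] [be -> beI]; exists (al + a *: (be + (-1) *: al)).
  by rewrite mulmxDr -!scalemxAr mulmxDr -scalemxAr scaleN1r.
by apply: supp_comb => //; exact: supp_comb.
Qed.

Lemma supported_span_sparse I x : (#|I| <= s)%N -> supported_span I x ->
  sparse_set D s x.
Proof.
move=> Is [al xE alI]; exists al => //.
exact: leq_trans (subset_leq_card alI) Is.
Qed.

(** The subspaces [supported_span I] are closed. *)
Lemma near_notin_supported_span I x : ~ supported_span I x ->
  \forall y \near x, ~ supported_span I y.
Proof.
move=> nx; pose W := \matrix_(i < p, j < n) (D j i *+ (i \in I)).
have WP y : supported_span I y <-> (y^T <= W)%MS.
  split.
    move=> [al -> /fintype.subsetP alI]; apply/submxP; exists al^T.
    apply/matrixP => i j; rewrite !mxE; apply: eq_bigr => k _.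
    rewrite !mxE ord1; have [kI|kI] := boolP (k \in I).
      by rewrite mulr1n mulrC.
    have /eqP -> : al k 0 == 0.
      by apply: contraNT kI => ak; apply: alI; rewrite inE.
    by rewrite mulr0 mul0r.
  move=> /submxP[a yE]; exists (\col_i (a 0 i *+ (i \in I))).
    apply: trmx_inj; rewrite yE; apply/matrixP => i j.
    rewrite !mxE ord1; apply: eq_bigr => k _; rewrite !mxE.
    by rewrite mulrnAr mulrnAr mulrC.
  apply/fintype.subsetP => i; rewrite inE mxE.
  by case: (i \in I); rewrite ?mulr0n ?eqxx.
(* Some linear form that vanishes on the subspace does not vanish at [x]. *)
have : x^T *m cokermx W != 0.
  by apply/negP => /eqP xW; apply/nx/WP; rewrite submxE xW.
case/matrix0Pn => i [k xk].
pose f y := \sum_l y l 0 * cokermx W l k.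
have fE y : (y^T *m cokermx W) i k = f y.
  by rewrite mxE; apply: eq_bigr => l _; rewrite mxE ord1.
have cf : f y @[y --> x] --> f x.
  have cl l : {for x, continuous (fun y : 'cV[R]_n => y l 0 * cokermx W l k)}.
    by apply: continuousM; [exact: coord_continuous|exact: cst_continuous].
  rewrite /f; exact: (cvg_big (@add_continuous _) (nbhs_filter x) (fun l _ => cl l)).
have f0 : f x != 0 by rewrite -fE.
have : \forall y \near x, f y != 0 by exact: (cvgr_neq0 _ cf f0).
apply: filterS => y fy /WP; rewrite submxE => /eqP yW.
by move: fy; rewrite -fE yW mxE eqxx.
Qed.

(** A ball that meets only the subspaces through [x] works: segments from [x] stay
    in each of these subspaces. *)
Lemma sparse_balanced_nbhd x : sparse_set D s x ->
  exists2 e : R, 0 < e &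
    balanced_nbhd (sparse_set D s) x (ball x e `&` sparse_set D s).
Proof.
move=> xS.
have : \forall y \near x, forall I, supported_span I y -> supported_span I x.
  apply: (@filter_forall _ _ (fun (I : {set 'I_p}) y =>
    supported_span I y -> supported_span I x) _ (nbhs_filter x)) => I.
  have [xI|nxI] := pselect (supported_span I x).
    by apply: nearW.
  by apply: filterS (near_notin_supported_span nxI).
move=> /nbhs_ballP[e /= e0 xe]; exists e => //; split.
- by exists (ball x e) => //; exact: ball_open.
- by split=> //; exact: ballxx.
- move=> y l [bxy yS] l1; split.
    move: bxy; rewrite -!ball_normE /= opprD addrA subrr sub0r normrN normrZ.
    rewrite distrC; apply: le_lt_trans.
    by rewrite ler_piMl.
  have [al yE als] := yS.
  have yI : supported_span (supp al) y by exists al.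
  apply: (supported_span_sparse als); apply: supported_span_line => //.
  exact: xe yI.
Qed.

Lemma feasible_column (r : 'cV[R]_p) (j : 'I_p) : (#|j |: supp r| <= s)%N ->
  forall n' (B : 'M[R]_(n', n)),
  (forall v, feasible_direction (sparse_set D s) (D *m r) v -> B *m v = 0) ->
  B *m col j D = 0.
Proof.
move=> js n' B HB; have [->|c0] := eqVneq (col j D) 0; first by rewrite mulmx0.
have rS : sparse_set D s (D *m r).
  by exists r => //; apply: leq_trans js; rewrite subset_leq_card// finset.subsetUr.
have [e e0 bal] := sparse_balanced_nbhd rS.
set x := D *m r in HB rS bal.
have N0 : 0 < `|col j D| by rewrite normr_gt0.
(* Half the radius, so that [x + t *: col j D] is in the open ball. *)
pose t := e / 2 / `|col j D|.
have t0 : 0 < t by rewrite !divr_gt0.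
suff : B *m (t *: col j D) = 0.
  by rewrite -scalemxAr => /eqP; rewrite scaler_eq0 gt_eqF//= => /eqP.
apply: HB; exists (ball x e `&` sparse_set D s), (x + t *: col j D); split => //.
- split.
    rewrite -ball_normE /= opprD addrA subrr sub0r normrN normrZ gtr0_norm//.
    by rewrite /t divfK ?gt_eqF// ltr_pdivrMr// ltr_pMr// ltr1n.
  apply: (supported_span_sparse js); exists (r + t *: delta_mx j 0).
    by rewrite mulmxDr -scalemxAr -colE.
  apply: supp_comb; first exact: finset.subsetUr.
  apply/fintype.subsetP => i; rewrite !inE mxE eqxx andbT.
  by case: (i == j) => //; rewrite eqxx.
- by rewrite -subr_eq0 addrC addKr scaler_eq0 negb_or c0 gt_eqF.
- by rewrite addrC addKr.
Qed.

Lemma spark_supp_cols (r : 'cV[R]_p) : ((norm0 r)%:R%:E < spark D)%E ->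
  \rank (supp_cols D r) = norm0 r.
Proof.
move=> spD.
have : free [seq col j D | j <- enum (supp r)].
  apply: contraTT spD => nfree; rewrite -leNgt /spark.
  exact: bigmin_le_cond.
pose X := [tuple of map (fun j => col j D) (enum_tuple (supp r))].
move=> /(@freeP _ _ _ X) fr.
rewrite -mxrank_tr; apply/eqP; rewrite -/(row_free _); apply: inj_row_free => v vU.
apply/rowP => i; rewrite [RHS]mxE; apply: (fr (v 0)) => //.
apply: trmx_inj; rewrite trmx0 -vU mulmx_sum_row linear_sum /=.
apply: eq_bigr => k _; rewrite linearZ /=; congr (_ *: _).
rewrite (nth_map (enum_val k)) -?cardE//.
apply/rowP => l; rewrite !mxE [in LHS](enum_val_nth (enum_val k))//.
by congr (D l _); apply: set_nth_default; rewrite -cardE.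
Qed.

End sparse_geometry.

(** * Covariance bounds *)

Theorem theorem3 (R : realType) (m n p s : nat)
    (A : 'M[R]_(m, n)) (D : 'M[R]_(n, p)) (sigma : R)
    (d : measure_display) (T : measurableType d) (P : probability T R)
    (w : 'I_m -> {RV P >-> R})
    (xhat : m.-tuple R -> 'cV[R]_n) (x : 'cV[R]_n) :
  \rank A = n -> (n <= p)%N -> \rank D = n ->
  (s < p)%N -> (((2 * s)%N%:R : R)%:E < spark D)%E ->
  0 < sigma -> iid_normal P sigma w ->
  sparse_set D s x ->
  (forall i, measurable_fun [set: m.-tuple R] (fun y => xhat y i 0)) ->
  cov_finite P A w xhat x ->
  (forall i, interchangeable (fun y x' => xhat y i 0 * density A sigma y x') x) ->
  unbiased_on P A w xhat (sparse_set D s) x ->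
  let r := sparse_rep D s x in
  ((norm0 r < s)%N ->
    psd_ge (cov_mx P A w xhat x) (sigma ^+ 2 *: invmx (A^T *m A))) /\
  (norm0 r = s ->
    let Q := range_proj (supp_cols D r) in
    psd_ge (cov_mx P A w xhat x)
      (sigma ^+ 2 *: pseudoinverse (Q *m A^T *m A *m Q))).
Proof.
move=> rA _ rD _ spD s0 wN xS mxhat fincov interch unb r.
set C := cov_mx P A w xhat x; set B := bias_gradient P A w xhat x.
have sne0 : sigma != 0 by rewrite gt_eqF.
have s2 : sigma ^+ 2 != 0 by rewrite expf_neq0.
have [xE rs] : x = D *m r /\ (norm0 r <= s)%N.
  have [al xal als] := xS.
  by apply: (@xgetPex _ 0 [set r | x = D *m r /\ (norm0 r <= s)%N]); exists al.
have sC : C^T = C by apply/matrixP => i j; rewrite !mxE covarianceC.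
have crb k (U : 'M[R]_(n, k)) : B *m U = 0 -> \rank U = k ->
    psd_ge C (sigma ^+ 2 *: (U *m invmx (U^T *m (A^T *m A) *m U) *m U^T)).
  move=> BU rU; apply: psd_ge_of_quadratic => //; first exact: gram_mul_unitmx.
  move=> v c; apply: cramer_rao_quadratic => //.
  by rewrite mulmxA -/B BU mul0mx.
have feas j : (#|j |: supp r| <= s)%N -> B *m col j D = 0.
  by move=> js; apply: (feasible_column js) => v; rewrite -xE; exact: unb.
split=> [rlt|req].
- have B0 : B = 0.
    have fD : row_free D by rewrite /row_free rD.
    (* [r] has a free slot, so every column of [D] is feasible. *)
    have BD : B *m D = 0.
      apply: mulmx_cols_eq0 => j; apply: feas.
      by rewrite cardsU1 (leq_trans _ rlt)// -add1n leq_add2r leq_b1.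
    by apply: (row_free_inj fD); rewrite BD mul0mx.
  have := crb n 1%:M; rewrite B0 mul0mx mxrank1 => /(_ erefl erefl).
  by rewrite trmx1 !mul1mx !mulmx1.
- move=> Q.
  have rU : \rank (supp_cols D r) = norm0 r.
    apply: spark_supp_cols; apply: le_lt_trans spD.
    by rewrite lee_fin ler_nat req leq_pmull.
  have BU : B *m supp_cols D r = 0.
    apply: mulmx_cols_eq0 => k.
    have -> : col k (supp_cols D r) = col (enum_val k) D.
      by apply/colP => i; rewrite !mxE.
    by apply: feas; rewrite (finset.setUidPr _) ?finset.sub1set ?enum_valP.
  rewrite /Q pseudoinverse_compression; first exact: crb.
    exact: gram_unitmx.
  exact: gram_mul_unitmx.
Qed.
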